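(* Let ${\rm SC}(\mathcal{Q})$ be the Simis cone of the covering polyhedron $\mathcal{Q}=\mathcal{Q}(C)$ and let $V(\mathcal{Q})=\{\beta_1,\ldots,\beta_r\}$ be the vertex set of $\mathcal{Q}$. The following hold. (a) ${\rm SC}(\mathcal{Q})=\mathbb{R}_+\{e_1,\dots,e_s,(\beta_1,1),\ldots,(\beta_r,1)\}$. (b) $\mathbb{R}_+e_1,\ldots,\mathbb{R}_+e_s,\mathbb{R}_+(\beta_1,1),\ldots,\mathbb{R}_+(\beta_r,1)$ are the extreme rays of ${\rm SC}(\mathcal{Q})$. (c) If $\mathcal{H}$ is the Hilbert basis of ${\rm SC}(\mathcal{Q})$, then $e_i\in\mathcal{H}$ for $i=1,\ldots,s$ and for each $(\beta_i,1)$ there is a unique $0\neq n_i\in\mathbb{N}$ such that $n_i(\beta_i,1)\in\mathcal{H}$. (d) If $\beta_i$ is integral, then $(\beta_i,1)\in\mathcal{H}$.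
   Context: $\mathbb{N}=\{0,1,\ldots\}$; vector inequalities are componentwise and $1$ also denotes $(1,\ldots,1)$. $C$ is an $s\times m$ matrix with non-negative rational entries and non-zero columns $c_1,\ldots,c_m$; its covering polyhedron is $\mathcal{Q}(C)=\{x\in\mathbb{R}^s\mid x\geq 0;\ xC\geq 1\}$ ($x$ a row vector). The Simis cone is ${\rm SC}(\mathcal{Q})=\{x\in\mathbb{R}^{s+1}\mid x\geq 0;\ \langle x,(c_i,-1)\rangle\geq 0\ \forall\, i\}$. Here $e_i$ is the $i$-th unit vector in $\mathbb{R}^{s+1}$, and $\mathbb{R}_+\Gamma$ denotes the cone generated by $\Gamma$ (all linear combinations of $\Gamma$ with non-negative real coefficients). An extreme ray of a pointed polyhedral cone is a face of dimension $1$. The Hilbert basis $\mathcal{H}$ of ${\rm SC}(\mathcal{Q})$ is the set of all integral vectors $0\neq\alpha\in{\rm SC}(\mathcal{Q})$ such that $\alpha$ is not the sum of two other non-zero integral vectors in ${\rm SC}(\mathcal{Q})$. *)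

(* Defs.v *)
From mathcomp Require Import all_boot all_order all_algebra.
From mathcomp Require Import boolp classical_sets cardinality reals.

Set Implicit Arguments.
Unset Strict Implicit.
Unset Printing Implicit Defensive.

Import Order.TTheory GRing.Theory Num.Theory.

Local Open Scope classical_set_scope.
Local Open Scope ring_scope.

Section ConvexGeometry.
Variables (R : realType) (n : nat).
Implicit Types (P F G : set 'rV[R]_n) (x a : 'rV[R]_n).

Definition inner x a : R := \sum_i x 0 i * a 0 i.

Definition integral_vector x : Prop := x \is a mxOver Num.int.

Definition cone_gen G : set 'rV[R]_n :=
  [set x | exists (k : nat) (g : 'I_k -> 'rV[R]_n) (c : 'I_k -> R),
    [/\ forall i, G (g i), forall i, 0 <= c i & x = \sum_i c i *: g i]].

Definition affine_hull G : set 'rV[R]_n :=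
  [set x | exists (k : nat) (g : 'I_k -> 'rV[R]_n) (c : 'I_k -> R),
    [/\ forall i, G (g i), \sum_i c i = 1 & x = \sum_i c i *: g i]].

(* The affine hull of F is a translate of the row space of some U of rank d;
   in particular this forces F to be nonempty. *)
Definition has_dim F (d : nat) : Prop :=
  exists (x0 : 'rV[R]_n) (U : 'M[R]_n),
    \rank U = d /\ affine_hull F = [set x0 + u | u in [set u | (u <= U)%MS]].

(* The case a = 0 gives the improper faces P (b = 0) and set0 (b > 0). *)
Definition face P F : Prop :=
  exists (a : 'rV[R]_n) (b : R),
    (forall x, P x -> inner x a <= b) /\ F = P `&` [set x | inner x a = b].

Definition vertices P : set 'rV[R]_n :=
  [set x | face P [set x] /\ has_dim [set x] 0].

(* Meant for pointed polyhedral cones P. *)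
Definition extreme_rays P : set (set 'rV[R]_n) :=
  [set F | face P F /\ has_dim F 1].

Definition hilbert_basis P : set 'rV[R]_n :=
  [set x | [/\ P x, integral_vector x, x != 0 &
    ~ exists y z : 'rV[R]_n,
        [/\ P y /\ P z, integral_vector y /\ integral_vector z,
            y != 0 /\ z != 0 & x = y + z]]].

End ConvexGeometry.

Section Simis.
Variables (R : realType) (s m : nat) (C : 'M[rat]_(s, m)).

Definition covering_polyhedron : set 'rV[R]_s :=
  [set x : 'rV[R]_s | (forall i, 0 <= x 0 i) /\
           (forall j, 1 <= (x *m map_mx ratr C) 0 j)].

Definition simis_cone : set 'rV[R]_(s + 1) :=
  [set x : 'rV[R]_(s + 1) | (forall i, 0 <= x 0 i) /\
           (forall j, 0 <= inner x
              (row_mx (col j (map_mx ratr C))^T (const_mx (- 1))))].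

(* Only e_1, ..., e_s: the last unit vector of R^(s+1) is excluded. *)
Definition unit_vec (i : 'I_s) : 'rV[R]_(s + 1) := delta_mx 0 (lshift 1 i).

Definition lift1 (x : 'rV[R]_s) : 'rV[R]_(s + 1) := row_mx x (const_mx 1).

End Simis.

Arguments covering_polyhedron R {s m} C.
Arguments simis_cone R {s m} C.
Arguments unit_vec R {s} i.

(* Main.v *)
Require Import Defs.
From mathcomp Require Import all_boot all_order all_algebra.
From mathcomp Require Import boolp classical_sets cardinality reals.

(** The Simis cone is a polyhedral cone [x M >= 0] with a rational matrix M,
    and it is pointed because the coordinate inequalities are among its
    constraints.  Everything follows from the theory of pointed polyhedral
    cones, organised around ray vectors: nonzero vectors of the cone that are
    determined up to a scalar by the constraints tight at them.

    - Minkowski's theorem for such a cone ([polycone_gen_rays]): subtracting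
      the largest admissible multiple of a suitable vector makes one more
      constraint tight, so by induction every vector is a nonnegative
      combination of ray vectors.
    - The extreme rays are exactly the half-lines of ray vectors
      ([ray_extreme], [extreme_rayE]): the sum of the constraints tight at a
      ray vector exposes its half-line, and conversely a one-dimensional face
      must contain one of the ray vectors that generate its points.
    - The ray vectors of a rational cone are scalar multiples of rational
      vectors ([ray_rational]), as they span the kernel of a rational matrix.

    It remains to see which vectors of the Simis cone are ray vectors.  At
    height 0 the cone is the nonnegative orthant and [C >= 0] makes [e_i]
    tight wherever a height-0 vector with positive i-th coordinate is, so only
    the [e_i] occur.  At height 1 the cone is the covering polyhedron, and a linear
    inequality exposing a vertex there homogenises to one exposing the ray
    above it; conversely, an inequality exposing a ray restricts to one
    exposing a vertex ([vertex_ray], [ray_vertex]).  This gives (a) and (b),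
    and finiteness, since a vertex is determined by its set of tight
    constraints.

    For (c) and (d), let g be a ray vector with a coordinate equal to 1.  Any
    decomposition of [N g] inside the cone stays on the ray, and that
    coordinate turns an integral summand into a natural multiple of g.  Hence
    the least N > 0 with [N g] integral gives an element of the Hilbert basis
    ([hilbert_ray]), and it is the only one on the ray, because any larger
    integral multiple splits off this one ([hilbert_ray_unique]). *)

Set Implicit Arguments.
Unset Strict Implicit.
Unset Printing Implicit Defensive.

Import Order.TTheory GRing.Theory Num.Theory.

Local Open Scope classical_set_scope.
Local Open Scope ring_scope.

(** * The scalar product as a matrix product *)

Section Inner.
Variables (R : realType) (n : nat).
Implicit Types x y a : 'rV[R]_n.

Lemma inner_mulmx x a : inner x a = (x *m a^T) 0 0.
Proof. by rewrite mxE; apply: eq_bigr => i _; rewrite mxE. Qed.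

Lemma inner0l a : inner 0 a = 0.
Proof. by rewrite inner_mulmx mul0mx mxE. Qed.

Lemma innerDl x y a : inner (x + y) a = inner x a + inner y a.
Proof. by rewrite !inner_mulmx mulmxDl mxE. Qed.

Lemma innerZl c x a : inner (c *: x) a = c * inner x a.
Proof. by rewrite !inner_mulmx -scalemxAl mxE. Qed.

Lemma inner_suml k (c : 'I_k -> R) (g : 'I_k -> 'rV[R]_n) a :
  inner (\sum_i c i *: g i) a = \sum_i c i * inner (g i) a.
Proof.
rewrite inner_mulmx mulmx_suml summxE; apply: eq_bigr => i _.
by rewrite -inner_mulmx innerZl.
Qed.

End Inner.

(** * Generated cones *)

Section ConeGen.
Variables (R : realType) (n : nat).
Implicit Types (x y : 'rV[R]_n) (G P : set 'rV[R]_n).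

Lemma cone_gen_min G P : P 0 -> (forall x y, P x -> P y -> P (x + y)) ->
  (forall c x, 0 <= c -> P x -> P (c *: x)) -> G `<=` P -> cone_gen G `<=` P.
Proof.
move=> P0 PD PZ sGP x [k [g [c [Gg c0 ->]]]].
by elim/big_ind: _ => // i _; apply: PZ => //; apply/sGP/Gg.
Qed.

Lemma cone_gen0 G : cone_gen G 0.
Proof.
by exists 0%N, (fun=> 0), (fun=> 0); split=> [[]|[]|] //; rewrite big_ord0.
Qed.

Lemma cone_genZ G c x : 0 <= c -> G x -> cone_gen G (c *: x).
Proof.
by move=> c0 Gx; exists 1%N, (fun=> x), (fun=> c); split=> //; rewrite big_ord1.
Qed.

Lemma cone_genD G x y : cone_gen G x -> cone_gen G y -> cone_gen G (x + y).
Proof.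
move=> [k [g [c [Gg c0 ->]]]] [l [h [d [Gh d0 ->]]]].
exists (k + l)%N, (fun i => match split i with inl i => g i | inr i => h i end),
  (fun i => match split i with inl i => c i | inr i => d i end).
split=> [i|i|]; [by case: split | by case: split|].
rewrite big_split_ord; congr (_ + _); apply: eq_bigr => i _.
  by rewrite (unsplitK (inl i)).
by rewrite (unsplitK (inr i)).
Qed.

Lemma cone_gen_scale G c x : 0 <= c -> cone_gen G x -> cone_gen G (c *: x).
Proof.
move=> c0 [k [g [d [Gg d0 ->]]]]; exists k, g, (fun i => c * d i).
split=> // [i|]; first exact: mulr_ge0.
by rewrite scaler_sumr; apply: eq_bigr => i _; rewrite scalerA.
Qed.

Lemma cone_gen1P x y :
  cone_gen [set x] y <-> exists2 c, 0 <= c & y = c *: x.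
Proof.
split=> [|[c c0 ->]]; last exact: cone_genZ.
pose ray := [set y | exists2 c, 0 <= c & y = c *: x].
apply: (@cone_gen_min _ ray) =>
  [|u v [c c0 ->] [d d0 ->]|c u c0 [d d0 ->]|u ->].
- by exists 0; rewrite ?scale0r.
- by exists (c + d); rewrite ?scalerDl ?addr_ge0.
- by exists (c * d); rewrite ?scalerA ?mulr_ge0.
- by exists 1; rewrite ?scale1r.
Qed.

Lemma cone_gen1_scale c x : 0 < c -> cone_gen [set c *: x] = cone_gen [set x].
Proof.
move=> c0; apply/seteqP; split=> y /cone_gen1P [d d0 ->]; apply/cone_gen1P.
  by exists (d * c); rewrite ?scalerA // mulr_ge0 // ltW.
by exists (d / c); rewrite ?divr_ge0 ?scalerA ?divfK ?gt_eqF // ltW.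
Qed.

End ConeGen.

(** * Ray vectors of pointed polyhedral cones *)

Section PolyhedralCone.
Variables (R : realType) (n k : nat) (M : 'M[R]_(n, k)).
Implicit Types x y w : 'rV[R]_n.

Definition polycone : set 'rV[R]_n := [set x | forall j, 0 <= (x *m M) 0 j].

Definition tight_le x y : Prop :=
  forall j, (x *m M) 0 j = 0 -> (y *m M) 0 j = 0.

(** An algebraic form of spanning an extreme ray: the constraints tight at x
    cut out the line through x. *)
Definition ray_vector x : Prop :=
  [/\ polycone x, x != 0 & forall y, tight_le x y -> exists c, y = c *: x].

Lemma polycone0 : polycone 0.
Proof. by move=> j; rewrite mul0mx mxE. Qed.

Lemma polyconeD x y : polycone x -> polycone y -> polycone (x + y).
Proof. by move=> Dx Dy j; rewrite mulmxDl mxE addr_ge0. Qed.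

Lemma polyconeZ c x : 0 <= c -> polycone x -> polycone (c *: x).
Proof. by move=> c0 Dx j; rewrite -scalemxAl mxE mulr_ge0. Qed.

(** A sum of nonnegative slacks vanishes only if each of them does. *)
Lemma tight_leDl x y z :
  polycone y -> polycone z -> x = y + z -> tight_le x y.
Proof.
move=> Dy Dz -> j; rewrite mulmxDl mxE => /eqP.
by rewrite paddr_eq0// => /andP[/eqP].
Qed.

Lemma ray_vectorZ c x : 0 < c -> ray_vector x -> ray_vector (c *: x).
Proof.
move=> c0 [Dx x0 xP]; split; first by apply: polyconeZ => //; apply: ltW.
  by rewrite scaler_eq0 negb_or gt_eqF.
move=> y cxy; have [|d ->] := xP y.
  by move=> j xj; apply: cxy; rewrite -scalemxAl mxE xj mulr0.
by exists (d / c); rewrite scalerA divfK ?gt_eqF.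
Qed.

Lemma mulmx_subZ x w t j :
  ((x - t *: w) *m M) 0 j = (x *m M) 0 j - t * (w *m M) 0 j.
Proof. by rewrite mulmxBl -scalemxAl !mxE. Qed.

Definition slack_support x := [set j | (x *m M) 0 j != 0]%SET.

(** The elementary descent: t is the largest multiple of w that can be
    subtracted from x inside the cone, the least ratio of the slack of x to the
    value of w over the constraints positive at w.  A constraint attaining it
    becomes tight, and no tight one is lost. *)
Lemma polycone_sub x w : polycone x -> tight_le x w ->
  (exists j, 0 < (w *m M) 0 j) ->
  exists2 t, 0 < t & polycone (x - t *: w) /\
    (#|slack_support (x - t *: w)%R| < #|slack_support x|)%N.
Proof.
move=> Dx xw [j0 wj0].
pose r j := (x *m M) 0 j / (w *m M) 0 j.
have [j wj jmin] := @Order.TotalTheory.arg_minP _ _ _ j0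
  (fun j => 0 < (w *m M) 0 j) r wj0.
have xpos i : 0 < (w *m M) 0 i -> 0 < (x *m M) 0 i.
  move=> wi; rewrite lt_def Dx andbT; apply/eqP => /xw wi0.
  by rewrite wi0 ltxx in wi.
have E i := mulmx_subZ x w (r j) i.
have r0 : 0 < r j by rewrite divr_gt0 // xpos.
exists (r j) => //; split=> [i|].
  rewrite E subr_ge0; case: (ltP 0 ((w *m M) 0 i)) => wi.
    by rewrite -ler_pdivlMr // jmin.
  by apply: le_trans (Dx i); rewrite mulr_ge0_le0 // ltW.
apply/proper_card/properP; split.
  apply/fintype.subsetP => i; rewrite !inE E; apply: contra => /eqP xi.
  by rewrite xi (xw _ xi) mulr0 subr0.
exists j; first by rewrite inE gt_eqF // xpos.
by rewrite inE negbK E divfK ?subrr // gt_eqF.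
Qed.

Hypothesis pointed : forall x, x *m M = 0 -> x = 0.

(** Pointedness in the form that makes [polycone_sub] applicable to a nonzero
    direction taken in the cone. *)
Lemma pointed_pos x : polycone x -> x != 0 -> exists j, 0 < (x *m M) 0 j.
Proof.
move=> Dx x0; apply: contrapT => nx; move/eqP: x0; apply; apply: pointed.
apply/rowP => j; rewrite [RHS]mxE; apply/eqP; rewrite eq_le Dx andbT leNgt.
by apply/negP => xj; apply: nx; exists j.
Qed.

Lemma polycone_scale_ge0 c x : x != 0 -> polycone x -> polycone (c *: x) ->
  0 <= c.
Proof.
move=> x0 Dx Dcx; have [j xj] := pointed_pos Dx x0.
by have := Dcx j; rewrite -scalemxAl mxE pmulr_lge0.
Qed.

(** Minkowski's theorem.  If x is not a ray vector, some w off the line of x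
    is tight wherever x is.  One descent along w gives x' in the cone, nonzero
    since w is off the line; a second descent from x, now along x', writes
    x = x'' + u x' with both terms in the cone and tight at more constraints.
    Two descents are needed because w itself may lie outside the cone. *)
Lemma polycone_gen_rays x : polycone x -> cone_gen ray_vector x.
Proof.
have [N] := ubnP #|slack_support x|; elim: N x => // N IH x xN Dx.
have [->|x0] := eqVneq x 0; first exact: cone_gen0.
have [xP|] := pselect (forall y, tight_le x y -> exists c, y = c *: x).
  by rewrite -[x]scale1r; apply: cone_genZ.
move=> /existsNP [y /not_implyP [xy ny]].
have IH' z : polycone z -> (#|slack_support z| < #|slack_support x|)%N ->
  cone_gen ray_vector z.
  by move=> Dz zx; apply: IH => //; apply: leq_trans zx _.
(* The descent needs a direction that is positive at some constraint: by
   pointedness y or - y is one. *)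
have [w [xw nw wpos]] : exists w,
    [/\ tight_le x w, ~ (exists c, w = c *: x) & exists j, 0 < (w *m M) 0 j].
  have [wpos|npos] := pselect (exists j, 0 < (y *m M) 0 j).
    by exists y.
  exists (- y); split.
  - by move=> j /xy; rewrite mulNmx !mxE => ->; rewrite oppr0.
  - by move=> [c yc]; apply: ny; exists (- c); rewrite scaleNr -yc opprK.
  apply: pointed_pos.
    move=> j; rewrite mulNmx mxE oppr_ge0 leNgt; apply/negP => yj.
    by apply: npos; exists j.
  by apply/eqP => y0; apply: ny; exists 0; rewrite scale0r -[y]opprK y0 oppr0.
have [t t0 [Dx' x'lt]] := polycone_sub Dx xw wpos.
set x' := x - t *: w in Dx' x'lt.
have x'0 : x' != 0.
  apply/eqP => /eqP; rewrite subr_eq0 => /eqP xt; apply: nw; exists t^-1.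
  by rewrite xt scalerA mulVf ?scale1r ?gt_eqF.
have xx' : tight_le x x'.
  by move=> j xj; rewrite mulmx_subZ xj (xw _ xj) mulr0 subr0.
have [u u0 [Dx'' x''lt]] := polycone_sub Dx xx' (pointed_pos Dx' x'0).
rewrite -[x](subrK (u *: x')); apply: cone_genD; first exact: IH'.
by apply: cone_gen_scale; [apply: ltW | apply: IH'].
Qed.

(** The half-line of a ray vector is exposed by minus the sum of the
    constraints tight at x: on the cone this sum vanishes only where each of
    them does. *)
Lemma ray_faceP x : ray_vector x -> exists a,
  (forall y, polycone y -> inner y a <= 0) /\
  (forall y, polycone y -> inner y a = 0 <-> cone_gen [set x] y).
Proof.
move=> [Dx x0 xP].
pose a := - (\sum_(j | (x *m M) 0 j == 0) (col j M)^T).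
have aE y : inner y a = - \sum_(j | (x *m M) 0 j == 0) (y *m M) 0 j.
  rewrite inner_mulmx linearN mulmxN mxE linear_sum mulmx_sumr summxE.
  by congr (- _); apply: eq_bigr => j _; rewrite /= trmxK colE mulmxA -colE mxE.
exists a; split=> y Dy; first by rewrite aE oppr_le0 sumr_ge0.
rewrite aE; split=> [/eqP|/cone_gen1P [c _ ->]].
  rewrite oppr_eq0 psumr_eq0 // => /allP ay.
  have [|c yc] := xP y.
    by move=> j /eqP xj; apply/eqP/(implyP (ay j _)); rewrite ?mem_index_enum.
  apply/cone_gen1P; exists c => //.
  by apply: (polycone_scale_ge0 x0 Dx); rewrite -yc.
rewrite big1 ?oppr0 // => j /eqP xj.
by rewrite -scalemxAl mxE xj mulr0.
Qed.

(** The half-line of x and its line have the same affine hull, since a point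
    [c x] is the affine combination of 0 and x with weights 1 - c and c. *)
Lemma ray_dim x : x != 0 -> has_dim (cone_gen [set x]) 1.
Proof.
move=> x0; exists 0, <<x>>%MS; split; first by rewrite mxrank_gen rank_rV x0.
apply/seteqP; split=> y.
  move=> [l [g [c [Gg _ ->]]]]; exists (\sum_i c i *: g i); rewrite ?add0r //=.
  apply: summx_sub => i _; apply: scalemx_sub; rewrite genmxE.
  by have /cone_gen1P [d _ ->] := Gg i; apply: scalemx_sub.
move=> [u /=]; rewrite genmxE => /sub_rVP [c ->] <-; rewrite add0r.
exists 2%N, (fun i => (i : nat)%:R *: x),
  (fun i : 'I_2 => if i == 0 then 1 - c else c).
split=> [i||]; first by apply/cone_gen1P; exists i%:R.
  by rewrite big_ord_recl big_ord1 /= subrK.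
by rewrite big_ord_recl big_ord1 /= scale0r scaler0 add0r scale1r.
Qed.

Lemma ray_extreme x : ray_vector x -> extreme_rays polycone (cone_gen [set x]).
Proof.
move=> rx; have [Dx x0 _] := rx; split; last exact: ray_dim.
have [a [a0 aP]] := ray_faceP rx; exists a, 0; split=> //.
apply/seteqP; split=> y.
  move=> xy; have [c c0 yc] := (cone_gen1P _ _).1 xy.
  have Dy : polycone y by rewrite yc; apply: polyconeZ.
  by split=> //; apply/aP.
by move=> [Dy /aP]; apply.
Qed.

(** Let x be a nonzero point of a one-dimensional face, so that the face lies
    on the line of x.  A ray vector occurring in a decomposition of x lies in
    the face as well, hence on that line, and so its half-line is the face. *)
Lemma extreme_rayE F : extreme_rays polycone F ->
  exists2 x, ray_vector x & F = cone_gen [set x].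
Proof.
move=> [[a [b [aP FE]]] [x0 [U [rU FU]]]].
have sF x : F x -> exists2 u, (u <= U)%MS & x = x0 + u.
  move=> Fx; have : affine_hull F x.
    exists 1%N, (fun=> x), (fun=> 1); split=> //; first by rewrite big_ord1.
    by rewrite big_ord1 scale1r.
  by rewrite FU => -[u uU <-]; exists u.
(* Otherwise the affine hull is at most the origin, of dimension 0. *)
have [x Fx xn0] : exists2 x, F x & x != 0.
  apply: contrapT => nF.
  have hull0 y : affine_hull F y -> y = 0.
    move=> [l [g [c [Fg _ ->]]]]; apply: big1 => i _.
    have [->|gi0] := eqVneq (g i) 0; first by rewrite scaler0.
    by exfalso; apply: nF; exists (g i).
  have U0 : U = 0.
    apply/row_matrixP => i; rewrite row0.
    have /hull0 h1 : affine_hull F (x0 + row i U).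
      by rewrite FU; exists (row i U) => //=; apply: row_sub.
    have /hull0 h2 : affine_hull F (x0 + 0).
      by rewrite FU; exists 0 => //=; apply: sub0mx.
    by rewrite -[row i U](addKr x0) h1 -{1}[x0]addr0 h2 oppr0 addr0.
  by move: rU; rewrite U0 mxrank0.
have [Dx xb] : polycone x /\ inner x a = b by move: Fx; rewrite FE.
(* The value b is attained at x and bounds the values at 0 and at 2 x. *)
have b0 : b = 0.
  apply/eqP; rewrite eq_le; apply/andP; split.
    have := aP _ (polyconeD Dx Dx).
    by rewrite innerDl xb -subr_ge0 opprD addNKr oppr_ge0.
  by rewrite -(inner0l a); apply/aP/polycone0.
have F0 : F 0 by rewrite FE; split; [apply: polycone0|rewrite /= inner0l].
have [u0 u0U e0] := sF _ F0.
have x0U : (x0 <= U)%MS.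
  by rewrite -[x0](addrK u0) -e0 sub0r -scaleN1r; apply: scalemx_sub.
have sFU y : F y -> (y <= U)%MS.
  by move=> /sF [u uU ->]; apply: addmx_sub.
have Ux : (U <= x)%MS.
  by rewrite -(geq_leqif (mxrank_leqif_sup (sFU _ Fx))) rank_rV xn0 rU.
have [l [g [c [gr c0 xE]]]] := polycone_gen_rays Dx.
have g0 i : polycone (g i) by case: (gr i).
have s0 : \sum_i c i * inner (g i) a = 0 by rewrite -inner_suml -xE xb b0.
have [i ci] : exists i, c i != 0.
  apply: contrapT => nc; move/eqP: xn0; apply; rewrite xE big1 // => i _.
  by have [->|ci] := eqVneq (c i) 0; [rewrite scale0r | case: nc; exists i].
have Fg : F (g i).
  rewrite FE; split=> //=; rewrite b0.
  have /eqP : - \sum_i c i * inner (g i) a = 0 by rewrite s0 oppr0.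
  rewrite -sumrN psumr_eq0 => [/allP/(_ i)|j _].
    rewrite mem_index_enum => /(_ isT) /=; rewrite oppr_eq0 mulf_eq0 (negPf ci).
    by move=> /eqP.
  by rewrite oppr_ge0 mulr_ge0_le0 // -[X in _ <= X]b0 aP.
exists (g i); first exact: gr.
have /sub_rVP [d gd] := submx_trans (sFU _ Fg) Ux.
have [_ gn0 _] := gr i.
have dn0 : d != 0 by apply: contraNneq gn0 => d0; rewrite gd d0 scale0r.
apply/seteqP; split=> y.
  move=> Fy; have /sub_rVP [e ye] := submx_trans (sFU _ Fy) Ux.
  have yg : y = (e / d) *: g i by rewrite gd scalerA divfK.
  apply/cone_gen1P; exists (e / d) => //.
  apply: (polycone_scale_ge0 gn0 (g0 i)); rewrite -yg.
  by move: Fy; rewrite FE => -[].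
move=> /cone_gen1P [e e_ge0 ->]; rewrite FE; split; first exact: polyconeZ.
by move: Fg; rewrite FE => -[_ /=]; rewrite innerZl => ->; rewrite b0 mulr0.
Qed.

End PolyhedralCone.
(** * Rational cones *)

Section RationalRays.
Variables (R : realType) (n k : nat) (A : 'M[rat]_(n, k)).

(** S selects the constraints tight at x, so x spans the kernel of the rational
    matrix A S.  Kernels commute with field extensions, hence a nonzero
    rational kernel vector exists, and x is a multiple of it. *)
Lemma ray_rational (x : 'rV[R]_n) : ray_vector (map_mx ratr A) x ->
  exists (v : 'rV[rat]_n) (c : R), x = c *: map_mx ratr v.
Proof.
move=> [Dx x0 xP].
pose S : 'M[rat]_k := diag_mx (\row_j (((x *m map_mx ratr A) 0 j == 0)%:R)).
have tightE (y : 'rV[R]_n) :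
    y *m map_mx ratr (A *m S) = 0 <-> tight_le (map_mx ratr A) x y.
  have E j : (y *m map_mx ratr (A *m S)) 0 j =
      (y *m map_mx ratr A) 0 j * ((x *m map_mx ratr A) 0 j == 0)%:R.
    by rewrite map_mxM mulmxA map_diag_mx mul_mx_diag !mxE rmorph_nat.
  split=> [y0 j /eqP xj|yP].
    by have := E j; rewrite y0 xj mulr1 mxE => <-.
  apply/rowP => j; rewrite E [RHS]mxE; have [/yP ->|_] := eqVneq.
    by rewrite mul0r.
  by rewrite mulr0.
have xK : (x <= map_mx ratr (kermx (A *m S)))%MS.
  by rewrite map_kermx; apply/sub_kermxP/tightE.
have [i Ki] : exists i, row i (kermx (A *m S)) != 0.
  apply: contrapT => nK; move/eqP: x0; apply; apply/eqP.
  rewrite -submx0; apply: submx_trans xK _.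
  rewrite (_ : kermx _ = 0) ?map_mx0 //; apply/row_matrixP => i; rewrite row0.
  by apply: contrapT => /eqP Ki; apply: nK; exists i.
have [|c vE] := xP (map_mx ratr (row i (kermx (A *m S)))).
  apply/tightE; rewrite -map_mxM -row_mul mulmx_ker row0 map_mx0 //.
exists (row i (kermx (A *m S))), c^-1.
rewrite vE scalerA mulVf ?scale1r //.
by apply: contraNneq Ki => c0; move/eqP: vE; rewrite c0 scale0r map_mx_eq0.
Qed.

(** Normalising one coordinate to 1 makes the whole vector rational, and the
    product of the denominators clears them. *)
Lemma ray_integral_multiple (g : 'rV[R]_n) k0 :
  ray_vector (map_mx ratr A) g -> g 0 k0 = 1 ->
  exists2 N, (0 < N)%N & integral_vector (N%:R *: g).
Proof.
move=> /ray_rational [v [c gE]] g1.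
have cE : c = ratr (v 0 k0)^-1.
  have cv : c * ratr (v 0 k0) = 1 by rewrite -g1 gE !mxE.
  have v0 : ratr (v 0 k0) != 0 :> R.
    by apply/eqP => v0; move/eqP: cv; rewrite v0 mulr0 eq_sym oner_eq0.
  by apply: (mulIf v0); rewrite cv fmorphV mulVf.
pose q i := (v 0 k0)^-1 * v 0 i.
have gq i : g 0 i = ratr (q i) by rewrite gE !mxE cE rmorphM.
pose d i := `|denq (q i)|%N.
exists (\prod_i d i)%N.
  by apply: prodn_gt0 => i; rewrite /d absz_gt0 denq_neq0.
apply/mxOverP => i0 i; rewrite ord1 mxE gq (bigD1 i) //= mulnC natrM -mulrA.
apply: rpredM; first exact: natr_int.
have -> : (d i)%:R * ratr (q i) = (numq (q i))%:~R :> R.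
  rewrite -ratr_nat -rmorphM /= -ratr_int; congr ratr.
  by rewrite numqE mulrC /d -[in RHS]absz_denq.
exact: intr_int.
Qed.

End RationalRays.

(** * Hilbert basis elements on a ray *)

Section HilbertRays.
Variables (R : realType) (n k : nat) (M : 'M[R]_(n, k)).
Hypothesis pointed : forall x : 'rV_n, x *m M = 0 -> x = 0.
Variables (g : 'rV[R]_n) (k0 : 'I_n).
Hypotheses (rg : ray_vector M g) (g1 : g 0 k0 = 1).

(** A summand y of [N g] in the cone is a nonnegative multiple of g, and the
    multiplier is the coordinate of y where g is 1, an integer. *)
Lemma ray_integral_summand (N : nat) y z : polycone M y -> polycone M z ->
  integral_vector y -> N%:R *: g = y + z -> exists p : nat, y = p%:R *: g.
Proof.
move=> Dy Dz /mxOverP yZ yzE; have [Dg gn0 gP] := rg.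
have [|c yc] := gP y.
  move=> j gj; apply: (tight_leDl Dy Dz yzE).
  by rewrite -scalemxAl mxE gj mulr0.
have c0 : 0 <= c by apply: (polycone_scale_ge0 pointed gn0 Dg); rewrite -yc.
have : c \is a Num.nat.
  by rewrite natrEint c0 andbT; have := yZ 0 k0; rewrite yc mxE g1 mulr1.
by move=> /natrP [p cp]; exists p; rewrite -cp.
Qed.

(** A decomposition of [N g] would be N = p + q with p, q positive and [p g]
    integral, contradicting the minimality of N. *)
Lemma hilbert_ray N : (0 < N)%N -> integral_vector (N%:R *: g) ->
  (forall N', (0 < N')%N -> integral_vector (N'%:R *: g) -> (N <= N')%N) ->
  hilbert_basis (polycone M) (N%:R *: g).
Proof.
move=> N0 NZ Nmin; have [Dg gn0 _] := rg; split=> //.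
- by apply: polyconeZ.
- by rewrite scaler_eq0 negb_or gn0 pnatr_eq0 -lt0n N0.
move=> [y [z [[Dy Dz] [yZ zZ] [y0 z0] E]]].
have [p yp] := ray_integral_summand Dy Dz yZ E.
have E' : N%:R *: g = z + y by rewrite addrC.
have [q zq] := ray_integral_summand Dz Dy zZ E'.
have p0 : (0 < p)%N.
  by rewrite lt0n; apply: contraNneq y0 => p0; rewrite yp p0 scale0r.
have q0 : (0 < q)%N.
  by rewrite lt0n; apply: contraNneq z0 => q0; rewrite zq q0 scale0r.
have /eqP : N%:R = (p + q)%:R :> R.
  by have /rowP/(_ k0) := E; rewrite yp zq !mxE g1 !mulr1 natrD.
rewrite eqr_nat => /eqP NE.
have := Nmin p p0; rewrite -yp => /(_ yZ).
by rewrite NE -{2}[p]addn0 leq_add2l leqNgt q0.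
Qed.

(** If N is the least positive integer with [N g] integral and N' > N is
    another one, then [N' g = N g + (N' - N) g] is decomposable. *)
Lemma hilbert_ray_unique :
  (exists2 N, (0 < N)%N & integral_vector (N%:R *: g)) ->
  exists! N : nat, N <> 0%N /\ hilbert_basis (polycone M) (N%:R *: g).
Proof.
move=> [N1 N1_gt0 N1Z].
have exN : exists N, (0 < N)%N && (N%:R *: g \is a mxOver Num.int).
  by exists N1; apply/andP.
case: (ex_minnP exN) => N /andP [N0 NZ] Nmin.
exists N; split.
  split; first by apply/eqP; rewrite -lt0n.
  by apply: hilbert_ray => // N' N'0 N'Z; apply: Nmin; rewrite N'0.
move=> N' [/eqP]; rewrite -lt0n => N'0 [DN' N'Z _ nsum].
have := Nmin N'; rewrite N'0 => /(_ N'Z); rewrite leq_eqVlt.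
move=> /predU1P [//|ltN].
have [Dg gn0 _] := rg.
have NE : (N' - N)%:R = N'%:R - N%:R :> R by rewrite natrB // ltnW.
exfalso; apply: nsum; exists (N%:R *: g), ((N' - N)%:R *: g); split.
- by split; apply: polyconeZ.
- split=> //; rewrite NE scalerBl; apply/mxOverP => i j.
  rewrite mxE [X in _ + X]mxE.
  by apply: rpredB; [apply/(mxOverP N'Z)|apply/(mxOverP NZ)].
- by split; rewrite scaler_eq0 negb_or gn0 andbT pnatr_eq0 -lt0n // subn_gt0.
- by rewrite NE scalerBl addrC subrK.
Qed.

End HilbertRays.

(** * The Simis cone *)

Section SimisCone.
Variables (R : realType) (s m : nat) (C : 'M[rat]_(s, m)).
Implicit Types (u v b : 'rV[R]_s) (t r : R) (x y : 'rV[R]_(s + 1)).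

Local Notation CR := (map_mx ratr C : 'M[R]_(s, m)).
Local Notation Q := (covering_polyhedron R C).
Local Notation SC := (simis_cone R C).

(** The point of the homogenising space above u at height t; [lift1 u] is by
    definition [homog u 1]. *)
Definition homog u t : 'rV[R]_(s + 1) := row_mx u (const_mx t).

Lemma homogK x : homog (lsubmx x) (x 0 (rshift s 0)) = x.
Proof.
rewrite -[RHS]hsubmxK; congr row_mx.
by apply/matrixP => i j; rewrite !mxE !ord1.
Qed.

Lemma homogE u t i : homog u t 0 (lshift 1 i) = u 0 i.
Proof. exact: row_mxEl. Qed.

Lemma homogE_last u t : homog u t 0 (rshift s 0) = t.
Proof. by rewrite row_mxEr mxE. Qed.

Lemma homogZ c u t : c *: homog u t = homog (c *: u) (c * t).
Proof.
by rewrite scale_row_mx; congr row_mx; apply/matrixP => i j; rewrite !mxE.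
Qed.

Lemma unit_homog i : unit_vec R i = homog (delta_mx 0 i) 0.
Proof.
rewrite -[LHS]homogK; congr homog; last by rewrite mxE eq_rlshift andbF.
by apply/rowP => j; rewrite !mxE eq_lshift.
Qed.

Lemma inner_homog u t (a : 'rV[R]_s) r :
  inner (homog u t) (row_mx a (const_mx r)) = inner u a + t * r.
Proof.
rewrite !inner_mulmx tr_row_mx mul_row_col [LHS]mxE; congr (_ + _).
by rewrite mxE big_ord1 !mxE.
Qed.

(** The columns of the identity block are the coordinate inequalities, those of
    the other block are the (c_j, -1). *)
Definition simis_mx : 'M[rat]_(s + 1, (s + 1) + m) :=
  row_mx 1%:M (col_mx C (const_mx (- 1))).

Local Notation M := (map_mx ratr simis_mx : 'M[R]_(s + 1, (s + 1) + m)).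

Lemma mul_simis_mx u t : homog u t *m M =
  row_mx (homog u t) (\row_j ((u *m CR) 0 j - t)).
Proof.
rewrite map_row_mx map_col_mx map_mx1 mul_mx_row mulmx1 mul_row_col.
congr row_mx; apply/rowP => j; rewrite [LHS]mxE [RHS]mxE; congr (_ + _).
by rewrite mxE big_ord1 !mxE rmorphN1 mulrN1.
Qed.

Lemma mul_simis_coord u t i :
  (homog u t *m M) 0 (lshift m (lshift 1 i)) = u 0 i.
Proof. by rewrite mul_simis_mx !row_mxEl. Qed.

Lemma mul_simis_last u t :
  (homog u t *m M) 0 (lshift m (rshift s 0)) = t.
Proof. by rewrite mul_simis_mx row_mxEl homogE_last. Qed.

Lemma mul_simis_col u t j :
  (homog u t *m M) 0 (rshift _ j) = (u *m CR) 0 j - t.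
Proof. by rewrite mul_simis_mx row_mxEr mxE. Qed.

Lemma simis_pointed x : x *m M = 0 -> x = 0.
Proof.
rewrite -[x]homogK mul_simis_mx => /eqP.
by rewrite row_mx_eq0 => /andP[/eqP ->].
Qed.

Lemma simis_coneE : SC = polycone M.
Proof.
have E u t j : inner (homog u t) (row_mx (col j CR)^T (const_mx (- 1))) =
    (u *m CR) 0 j - t.
  by rewrite inner_homog mulrN1 inner_mulmx trmxK colE mulmxA -colE mxE.
apply/seteqP; split=> x; rewrite -[x]homogK.
  move=> [x0 xC] j; case: (split_ordP j) => l ->.
    by rewrite mul_simis_mx row_mxEl.
  by rewrite mul_simis_col -E.
move=> Dx; split=> j.
  by have := Dx (lshift m j); rewrite mul_simis_mx row_mxEl.
by have := Dx (rshift _ j); rewrite mul_simis_col E.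
Qed.

Lemma simis_homog u t : polycone M (homog u t) <->
  [/\ forall i, 0 <= u 0 i, 0 <= t & forall j, t <= (u *m CR) 0 j].
Proof.
split=> [Dx|[u0 t0 ut] j].
  split=> [i||j].
  - by have := Dx (lshift m (lshift 1 i)); rewrite mul_simis_coord.
  - by have := Dx (lshift m (rshift s 0)); rewrite mul_simis_last.
  - by have := Dx (rshift _ j); rewrite mul_simis_col subr_ge0.
case: (split_ordP j) => l ->; last by rewrite mul_simis_col subr_ge0.
case: (split_ordP l) => l' ->; first by rewrite mul_simis_coord.
by rewrite ord1 mul_simis_last.
Qed.

Lemma tight_homog u t v r : tight_le M (homog u t) (homog v r) <->
  [/\ forall i, u 0 i = 0 -> v 0 i = 0, t = 0 -> r = 0 &
      forall j, (u *m CR) 0 j = t -> (v *m CR) 0 j = r].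
Proof.
split=> [T|[T1 T2 T3] j].
  split=> [i||j].
  - by have := T (lshift m (lshift 1 i)); rewrite !mul_simis_coord.
  - by have := T (lshift m (rshift s 0)); rewrite !mul_simis_last.
  - have := T (rshift _ j); rewrite !mul_simis_col => {}T /eqP.
    by rewrite -subr_eq0 => /eqP/T/subr0_eq.
case: (split_ordP j) => l ->; last first.
  by rewrite !mul_simis_col => /subr0_eq/T3 ->; rewrite subrr.
case: (split_ordP l) => l' ->; first by rewrite !mul_simis_coord; apply: T1.
by rewrite ord1 !mul_simis_last.
Qed.

Lemma simis_lift1 u : polycone M (lift1 u) <-> Q u.
Proof.
split=> [/simis_homog [? _ ?]|[? ?]]; first by split.
by apply/simis_homog; split.
Qed.

Hypothesis C_ge0 : forall i j, 0 <= C i j.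

Lemma simis_unit i : polycone M (unit_vec R i).
Proof.
rewrite unit_homog; apply/simis_homog; split=> // [j|j].
  by rewrite mxE ler0n.
by rewrite -rowE !mxE ler0q.
Qed.

Lemma unit_ray i : ray_vector M (unit_vec R i).
Proof.
split; first exact: simis_unit.
  apply/eqP => /rowP/(_ (lshift 1 i)); rewrite !mxE !eqxx => /eqP.
  by rewrite oner_eq0.
move=> y; rewrite unit_homog -[y]homogK => /tight_homog [T1 T2 _].
exists (lsubmx y 0 i); rewrite homogZ mulr0 T2 //; congr homog.
apply/rowP => j; have [->|ji] := eqVneq j i; first by rewrite !mxE !eqxx mulr1.
by rewrite T1 !mxE ?(negPf ji) ?mulr0.
Qed.

(** For a positive coordinate i of u, nonnegativity of C makes each constraint
    tight at u also tight at [e_i]; a ray vector is therefore a multiple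
    of [e_i]. *)
Lemma ray_at_infinity u : ray_vector M (homog u 0) ->
  exists i c, 0 < c /\ homog u 0 = c *: unit_vec R i.
Proof.
move=> [/simis_homog [u0 _ _] x0 xP].
have [i ui] : exists i, u 0 i != 0.
  apply: contrapT => nu; move/eqP: x0; apply.
  suff -> : u = 0 by rewrite /homog (_ : const_mx 0 = 0) ?row_mx0.
  apply/rowP => i; rewrite mxE.
  by apply: contrapT => /eqP ui; apply: nu; exists i.
have [|c eE] := xP (unit_vec R i).
  rewrite unit_homog; apply/tight_homog; split=> // j.
    move=> uj; have ji : j != i by apply: contraNneq ui => <-; apply/eqP.
    by rewrite mxE eqxx (negPf ji).
  rewrite mxE => /eqP; rewrite psumr_eq0 => [/allP/(_ i)|l _]; last first.
    by rewrite mulr_ge0 // mxE ler0q.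
  rewrite mem_index_enum => /(_ isT) /=; rewrite mulf_eq0 (negPf ui) /=.
  move=> /eqP Cij.
  by rewrite -rowE mxE.
have c1 : c * u 0 i = 1.
  move: eE => /rowP/(_ (lshift 1 i)).
  by rewrite unit_homog homogZ !homogE !mxE !eqxx.
have ui0 : 0 < u 0 i by rewrite lt_def ui u0.
exists i, (u 0 i); split=> //.
by rewrite eE scalerA mulrC c1 scale1r.
Qed.

(** If a functional a with value at most d on the polyhedron exposes b, then
    (a, -d) exposes the ray of (b, 1) in the cone.  At positive height this
    is seen by scaling to height 1, and at height 0 by translating b, which
    stays in the polyhedron.  The half-line is thus an extreme ray, so it is
    the half-line of some ray vector, of which (b, 1) is a multiple. *)
Lemma vertex_ray b : vertices Q b -> ray_vector M (lift1 b).
Proof.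
move=> [[a [d [aQ bE]]] _].
have [Qb bd] : Q b /\ inner b a = d.
  by have : [set b] b by []; rewrite {1}bE.
have Db := (simis_lift1 b).2 Qb.
have Qdiv u t : 0 < t -> polycone M (homog u t) -> Q (t^-1 *: u).
  move=> t0 Dx; apply/simis_lift1.
  rewrite (_ : lift1 _ = t^-1 *: homog u t); last first.
    by rewrite homogZ mulVf ?gt_eqF.
  by apply: polyconeZ => //; rewrite invr_ge0 ltW.
have Qtr u : polycone M (homog u 0) -> Q (b + u).
  move=> Du; apply/simis_lift1.
  rewrite (_ : lift1 _ = lift1 b + homog u 0); first exact: polyconeD.
  by rewrite add_row_mx; congr row_mx; apply/matrixP => i j; rewrite !mxE addr0.
have lift_neq0 : lift1 b != 0.
  apply/eqP => /rowP/(_ (rshift s 0)); rewrite homogE_last mxE => /eqP.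
  by rewrite oner_eq0.
have ext : extreme_rays (polycone M) (cone_gen [set lift1 b]).
  split; last exact: ray_dim.
  have phiE u t :
      inner (homog u t) (row_mx a (const_mx (- d))) = inner u a - t * d.
    by rewrite inner_homog mulrN.
  exists (row_mx a (const_mx (- d))), 0; split=> [x|].
    rewrite -[x]homogK; move: (lsubmx x) (x 0 _) => u t Dx.
    have [_ t0 _] := (simis_homog _ _).1 Dx; rewrite phiE.
    move: t0; rewrite le_eqVlt => /predU1P [t0|t0].
      rewrite -t0 in Dx *; have := aQ _ (Qtr _ Dx).
      by rewrite innerDl bd mul0r subr0 gerDl.
    have := aQ _ (Qdiv _ _ t0 Dx).
    by rewrite innerZl mulrC ler_pdivrMr // subr_le0 [d * _]mulrC.
  apply/seteqP; split=> x.
    move=> /cone_gen1P [c c0 ->]; split; first exact: polyconeZ.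
    by rewrite /= homogZ phiE innerZl bd mulr1 subrr.
  rewrite -[x]homogK; move: (lsubmx x) (x 0 _) => u t [Dx] /=.
  have [_ t0 _] := (simis_homog _ _).1 Dx; rewrite phiE => /eqP.
  rewrite subr_eq0 => /eqP ua.
  have inb v : Q v -> inner v a = d -> v = b.
    by move=> Qv vd; suff : [set b] v by []; rewrite bE.
  apply/cone_gen1P; exists t => //; rewrite homogZ mulr1.
  move: t0; rewrite le_eqVlt => /predU1P [t0|t0].
    rewrite -t0 in Dx ua *; congr homog.
    apply: (addrI b); rewrite scale0r addr0; apply: inb; first exact: Qtr.
    by rewrite innerDl bd ua mul0r addr0.
  congr homog; rewrite -(inb _ (Qdiv _ _ t0 Dx)).
    by rewrite scalerA mulfV ?scale1r ?gt_eqF.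
  by rewrite innerZl ua mulrA mulVf ?mul1r ?gt_eqF.
have [x rx xE] := extreme_rayE simis_pointed ext.
have [c c0 bc] : exists2 c, 0 <= c & lift1 b = c *: x.
  apply/cone_gen1P; rewrite -xE -[X in cone_gen _ X]scale1r.
  exact: cone_genZ.
rewrite bc; apply: ray_vectorZ => //; rewrite lt_def c0 andbT.
by apply: contraNneq lift_neq0 => c_eq0; rewrite bc c_eq0 scale0r.
Qed.

(** A functional exposing the ray of (u, 1) restricts, on the slice of height
    1, to an affine function exposing u in the polyhedron. *)
Lemma ray_vertex u : ray_vector M (lift1 u) -> vertices Q u.
Proof.
move=> ru; have [Du _ _] := ru; split; last first.
  exists u, 0; split; first by rewrite mxrank0.
  apply/seteqP; split=> x.
    move=> [l [g [c [gu c1 ->]]]]; exists 0; rewrite ?addr0 /=.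
      exact: sub0mx.
    rewrite (eq_bigr (fun i => c i *: u)) => [|i _]; last by rewrite (gu i).
    by rewrite -scaler_suml c1 scale1r.
  move=> [v /=]; rewrite submx0 => /eqP -> <-; rewrite addr0.
  by exists 1%N, (fun=> u), (fun=> 1); split=> //; rewrite big_ord1 ?scale1r.
have [a [a0 aP]] := ray_faceP simis_pointed ru.
have aE v : inner (lift1 v) a = inner v (lsubmx a) + a 0 (rshift s 0).
  by rewrite -[a in LHS]homogK inner_homog mul1r.
exists (lsubmx a), (- a 0 (rshift s 0)); split=> [x /simis_lift1 /a0|].
  by rewrite aE -lerBrDr sub0r.
apply/seteqP; split=> x.
  move=> ->; split; first exact/simis_lift1.
  apply/eqP; rewrite /= -addr_eq0 -aE; apply/eqP/aP => //.
  by rewrite -[X in cone_gen _ X]scale1r; apply: cone_genZ.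
move=> [/simis_lift1 Dx /eqP]; rewrite -addr_eq0 -aE => /eqP /(aP _ Dx).
move=> /cone_gen1P [c _ E].
have c1 : 1 = c.
  by have /rowP/(_ (rshift s 0)) := E; rewrite homogZ !homogE_last mulr1.
by move: E; rewrite -c1 scale1r => /eq_row_mx [].
Qed.

(** A ray vector of height 0 is a multiple of a unit vector by
    [ray_at_infinity]; one of positive height rescales to height 1, where it
    is a lifted vertex. *)
Lemma simis_ray_class x : ray_vector M x ->
  exists (c : R) (g : 'rV[R]_(s + 1)), [/\ 0 < c, x = c *: g &
    (exists i, g = unit_vec R i) \/ (exists2 b, vertices Q b & g = lift1 b)].
Proof.
rewrite -[x]homogK; move: (lsubmx x) (x 0 _) => u t ru.
have [/simis_homog [_ t0 _] _ _] := ru.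
move: t0; rewrite le_eqVlt => /predU1P [t0|t0].
  rewrite -t0 in ru *; have [i [c [c0 E]]] := ray_at_infinity ru.
  by exists c, (unit_vec R i); split=> //; left; exists i.
have E : lift1 (t^-1 *: u) = t^-1 *: homog u t by rewrite homogZ mulVf ?gt_eqF.
exists t, (lift1 (t^-1 *: u)); split=> //.
  by rewrite E scalerA mulfV ?scale1r ?gt_eqF.
right; exists (t^-1 *: u) => //; apply: ray_vertex.
by rewrite E; apply: ray_vectorZ => //; rewrite invr_gt0.
Qed.

(** Two vertices with the same tight constraints have proportional lifts,
    which are equal since both have height 1. *)
Lemma finite_vertices : finite_set (vertices Q).
Proof.
pose T b := slack_support M (lift1 b).
have Tinj : {in vertices Q &, injective T}.
  move=> b b'; rewrite !inE => /vertex_ray [_ _ bP] _ bb'.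
  have [|c] := bP (lift1 b').
    move=> j /eqP bj; apply/eqP; move: bb' => /setP/(_ j).
    by rewrite !inE bj /= => /esym/negbFE.
  rewrite homogZ mulr1 => E.
  have c1 : 1 = c by have /rowP/(_ (rshift s 0)) := E; rewrite !homogE_last.
  by move: E; rewrite -c1 scale1r => /eq_row_mx [].
(* The image of T consists of subsets of a finite set of constraints. *)
by rewrite -(eq_finite_set (inj_card_eq Tinj)); apply: finite_finset.
Qed.

Lemma simis_generators :
  polycone M = cone_gen (range (unit_vec R) `|` (@lift1 R s @` vertices Q)).
Proof.
set G := _ `|` _.
apply/seteqP; split.
  move=> x /(polycone_gen_rays simis_pointed).
  apply: (@cone_gen_min _ _ _ (cone_gen G)).
  - exact: cone_gen0.
  - exact: cone_genD.
  - by move=> c y; apply: cone_gen_scale.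
  move=> y /simis_ray_class [c [g [c0 -> Gg]]].
  apply: cone_genZ; first exact: ltW.
  by case: Gg => [[i ->]|[b Vb ->]]; [left; exists i|right; exists b].
apply: cone_gen_min.
- exact: polycone0.
- exact: polyconeD.
- exact: polyconeZ.
by move=> _ [[i _ <-]|[b /vertex_ray [Db _ _] <-]] //; apply: simis_unit.
Qed.

Lemma simis_extreme_rays : extreme_rays (polycone M) =
  [set cone_gen [set unit_vec R i] | i in [set: 'I_s]] `|`
  [set cone_gen [set lift1 b] | b in vertices Q].
Proof.
apply/seteqP; split=> F.
  move=> /(extreme_rayE simis_pointed) [x].
  move=> /simis_ray_class [c [g [c0 -> Gg]]] ->.
  rewrite cone_gen1_scale //.
  by case: Gg => [[i ->]|[b Vb ->]]; [left; exists i|right; exists b].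
move=> [[i _ <-]|[b Vb <-]]; apply: (ray_extreme simis_pointed).
  exact: unit_ray.
exact: vertex_ray.
Qed.

Lemma hilbert_simis_ray (g : 'rV[R]_(s + 1)) k0 : ray_vector M g ->
  g 0 k0 = 1 -> integral_vector g -> hilbert_basis (polycone M) g.
Proof.
move=> rg g1 gZ; rewrite -[g]scale1r -[1]/(1%:R).
by apply: (hilbert_ray simis_pointed rg g1); rewrite ?scale1r.
Qed.

End SimisCone.

Theorem proposition3p14 (R : realType) (s m : nat) (C : 'M[rat]_(s, m))
    (C_ge0 : forall i j, 0 <= C i j) (C_col_neq0 : forall j, col j C != 0) :
  let SC := simis_cone R C in
  let V := vertices (covering_polyhedron R C) in
  let H := hilbert_basis SC in
  finite_set V /\
  (* (a) *)
  SC = cone_gen (range (unit_vec R) `|` (@lift1 R s @` V)) /\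
  (* (b) *)
  extreme_rays SC =
    [set cone_gen [set unit_vec R i] | i in [set: 'I_s]] `|`
    [set cone_gen [set lift1 b] | b in V] /\
  (* (c) *)
  ((forall i : 'I_s, H (unit_vec R i)) /\
   (forall b, V b ->
      exists! n : nat, n <> 0%N /\ H (n%:R *: lift1 b))) /\
  (* (d) *)
  (forall b, V b -> integral_vector b -> H (lift1 b)).
Proof.
move=> SC V H; rewrite /H /SC simis_coneE.
have last1 (b : 'rV[R]_s) : lift1 b 0 (rshift s 0) = 1 by exact: homogE_last.
split; first exact: finite_vertices.
split; first exact: simis_generators.
split; first exact: simis_extreme_rays.
split; [split=> [i|b Vb]|move=> b Vb bZ].
- apply: (hilbert_simis_ray (k0 := lshift 1 i) (unit_ray R C_ge0 i)).
    by rewrite mxE !eqxx.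
  by apply/mxOverP => j l; rewrite mxE; apply: natr_int.
- have rb := vertex_ray Vb.
  apply: (hilbert_ray_unique (simis_pointed (C := C)) rb (last1 b)).
  exact: ray_integral_multiple rb (last1 b).
- apply: (hilbert_simis_ray (vertex_ray Vb) (last1 b)).
  apply/mxOverP => i j; rewrite ord1; case: (split_ordP j) => l ->.
    by rewrite row_mxEl; apply/(mxOverP bZ).
  by rewrite row_mxEr mxE; apply: int_num1.
Qed.
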